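(* For any integers $r\ge r'\ge 1$, $$\gamma_{\rm sp}(K_{1,r}\Box K_{1,r'})=rr'+1.$$
   Context: All graphs are finite, simple and undirected; $K_{1,r}$ is the star with $r$ leaves. For a vertex $v$, $N(v)$ is its set of neighbours; for $D\subseteq V(G)$, $\overline{D}=V(G)\setminus D$. A set $D\subseteq V(G)$ is a super dominating set of $G$ if for every $u\in\overline{D}$ there exists $v\in D$ such that $N(v)\cap\overline{D}=\{u\}$; the super domination number $\gamma_{\rm sp}(G)$ is the minimum cardinality of a super dominating set of $G$. The Cartesian product $G\Box H$ has vertex set $V(G)\times V(H)$, with $(g,h)$ adjacent to $(g',h')$ iff either $g=g'$ and $hh'\in E(H)$, or $gg'\in E(G)$ and $h=h'$. *)

(* Defs.v *)
From HB Require Import structures.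
From mathcomp Require Import all_boot.

Set Implicit Arguments.
Unset Strict Implicit.
Unset Printing Implicit Defensive.

Record sgraph := SGraph {
  vertex :> finType;
  adj : rel vertex;
  adj_sym : symmetric adj;
  adj_irrefl : irreflexive adj
}.

Section SuperDomination.
Variable G : sgraph.
Implicit Types (v : G) (D : {set G}).

Definition nbh v : {set G} := [set w | adj v w].

Definition super_dominating D : bool :=
  [forall u in ~: D, [exists v in D, nbh v :&: ~: D == [set u]]].

Lemma super_dominatingP D :
  reflect (forall u, u \in ~: D ->
             exists2 v, v \in D & nbh v :&: ~: D = [set u])
          (super_dominating D).
Proof.
apply: (iffP forall_inP) => H u /H.
  by case/exists_inP=> v vD /eqP; exists v.
by case=> v vD /eqP E; apply/exists_inP; exists v.
Qed.

Lemma super_dominatingT : super_dominating [set: G].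
Proof. by apply/super_dominatingP => u; rewrite setCT inE. Qed.

Definition gamma_sp : nat :=
  #|[arg min_(D < [set: G] | super_dominating D) #|D| ]|.

Lemma gamma_spP :
  (exists2 D, super_dominating D & #|D| = gamma_sp) /\
  (forall D, super_dominating D -> gamma_sp <= #|D|).
Proof.
rewrite /gamma_sp; case: arg_minnP => [|D sD minD].
  exact: super_dominatingT.
by split=> //; exists D.
Qed.

End SuperDomination.

Section CartesianProduct.
Variables G H : sgraph.

Definition box_adj : rel (G * H) := fun x y =>
  (x.1 == y.1) && adj x.2 y.2 || adj x.1 y.1 && (x.2 == y.2).

Lemma box_adj_sym : symmetric box_adj.
Proof.
by move=> x y; rewrite /box_adj ![adj x.1 _]adj_sym ![adj x.2 _]adj_sym
  [x.1 == _]eq_sym [x.2 == _]eq_sym.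
Qed.

Lemma box_adj_irrefl : irreflexive box_adj.
Proof. by move=> x; rewrite /box_adj !adj_irrefl andbF. Qed.

Definition box : sgraph := SGraph box_adj_sym box_adj_irrefl.

End CartesianProduct.

Section Star.
Variable r : nat.

(* The centre of the star is ord0; the r leaves are the nonzero ordinals. *)
Definition star_adj : rel 'I_r.+1 := fun x y => (x == ord0) != (y == ord0).

Lemma star_adj_sym : symmetric star_adj.
Proof. by move=> x y; rewrite /star_adj eq_sym. Qed.

Lemma star_adj_irrefl : irreflexive star_adj.
Proof. by move=> x; rewrite /star_adj eqxx. Qed.

Definition star : sgraph := SGraph star_adj_sym star_adj_irrefl.

End Star.

(* Main.v *)
Require Import Defs.
From mathcomp Require Import all_boot.

(** The vertices with exactly one central coordinate form a vertex cover of
    size [r + r'], which bounds the complement of any super dominating set.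
    Conversely, if [f] maps leaves to leaves, the vertices [(0, j)] with [j] a
    leaf and [(i, f i)] with [i] a leaf form a set of size [r + r'] avoiding
    [(0, 0)].  The only such vertex adjacent to [(i, 0)] is [(i, f i)], and
    [(i, j)] with [f i <> j] has [(0, j)] as its only neighbour among them.  With [f i = min i r'] such an
    [i] exists for every [j] unless [r' = 1], when [(0, 0)] serves instead. *)

Set Implicit Arguments.
Unset Strict Implicit.
Unset Printing Implicit Defensive.

(** Inject [~: D] into [X]: keep [u] if it lies in [X], else send it to some [v] in [D] with [nbh v
    :&: ~: D = [set u]]; covering the edge [uv] puts [v] in [X]. Kept vertices lie outside [D], the
    chosen ones inside, and [v] determines [u]. *)
Lemma super_dominating_cover (G : sgraph) (X D : {set G}) :
  (forall u v, adj u v -> (u \in X) || (v \in X)) ->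
  super_dominating D -> #|~: D| <= #|X|.
Proof.
move=> coverX /super_dominatingP sD.
pose p u v := (v \in D) && (nbh v :&: ~: D == [set u]).
(* For [u] outside [D] the default is never reached. *)
pose g u := if u \in X then u else odflt u [pick v | p u v].
have gP u : u \notin D -> u \notin X -> g u \in X /\ p u (g u).
  move=> uD uX; rewrite /g (negbTE uX); case: pickP => /= [v pv | none].
    split=> //; case/andP: pv => _ /eqP E.
    have: u \in nbh v :&: ~: D by rewrite E set11.
    by rewrite !inE => /andP[/coverX]; rewrite (negbTE uX) orbF.
  have [|v vD E] := sD u; first by rewrite inE.
  by have := none v; rewrite /p vD E eqxx.
have g_id u : u \in X -> g u = u by rewrite /g => ->.
have gX u : u \notin D -> g u \in X.
  by move=> uD; case uX: (u \in X); [rewrite g_id | case: (gP u uD (negbT uX))].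
have g_inj : {in ~: D &, injective g}.
  move=> u w; rewrite !inE => uD wD.
  case uX: (u \in X); case wX: (w \in X).
  - by rewrite !g_id.
  - have [_ /andP[gD _]] := gP w wD (negbT wX).
    by rewrite (g_id u) // => E; rewrite -E (negbTE uD) in gD.
  - have [_ /andP[gD _]] := gP u uD (negbT uX).
    by rewrite (g_id w) // => E; rewrite E (negbTE wD) in gD.
  have [_ /andP[_ /eqP Eu]] := gP u uD (negbT uX).
  have [_ /andP[_ /eqP Ew]] := gP w wD (negbT wX).
  by move=> E; apply/set1_inj; rewrite -Eu -Ew E.
rewrite -(card_in_imset g_inj); apply/subset_leq_card/subsetP => _ /imsetP[u uD ->].
by apply: gX; rewrite inE in uD.
Qed.

Section StarProduct.
Variables r r' : nat.

Definition graph_cross (f : 'I_r.+1 -> 'I_r'.+1) : {set box (star r) (star r')} :=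
  [set x | if x.1 == ord0 then x.2 != ord0 else x.2 == f x.1].

Lemma card_graph_cross (f : 'I_r.+1 -> 'I_r'.+1) : #|graph_cross f| = r + r'.
Proof.
pose h (s : 'I_r + 'I_r') : box (star r) (star r') :=
  match s with
  | inl i => (lift ord0 i, f (lift ord0 i))
  | inr j => (ord0, lift ord0 j)
  end.
have h_inj : injective h.
  case=> [i|j] [k|l] //= E.
  - by rewrite (lift_inj (congr1 fst E)).
  - by rewrite (lift_inj (congr1 snd E)).
suff -> : graph_cross f = h @: [set: 'I_r + 'I_r'].
  by rewrite card_imset // cardsT card_sum !card_ord.
apply/setP=> -[i j]; rewrite inE /=; apply/idP/imsetP => [|[[k|l] _ [-> ->]] //].
  case: (unliftP ord0 i) => [k ->|->] /=; first by move/eqP->; exists (inl k); rewrite ?inE.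
  by case: (unliftP ord0 j) => [l ->|->] //= _; exists (inr l); rewrite ?inE.
by rewrite /= eqxx.
Qed.

Lemma graph_cross0_cover (u v : box (star r) (star r')) :
  adj u v -> (u \in graph_cross (fun=> ord0)) || (v \in graph_cross (fun=> ord0)).
Proof.
case: u v => [a b] [c d]; rewrite !inE /= /box_adj /= /star_adj.
case/orP=> /andP[].
  by move/eqP->; case: (c == ord0); case: (b == ord0); case: (d == ord0).
by move=> + /eqP->; case: (a == ord0); case: (c == ord0); case: (d == ord0).
Qed.

Lemma super_dominating_graph_cross (f : 'I_r.+1 -> 'I_r'.+1) :
  (forall i, i != ord0 -> f i != ord0) ->
  (forall j, j != ord0 ->
     (exists2 i, i != ord0 & f i != j) \/ (forall k, k != ord0 -> k = j)) ->
  super_dominating (~: graph_cross f).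
Proof.
move=> f0 fj; apply/super_dominatingP => -[a b]; rewrite setCK inE /=.
case: (eqVneq a ord0) => [-> b0|a0 /eqP->].
  case: (fj b b0) => [[i i0 fib]|one].
    (* The neighbours of [(i, b)] are [(0, b)] and [(i, 0)]; the latter is off the cross because
       [f i] is a leaf. *)
    exists (i, b); first by rewrite !inE /= (negbTE i0) eq_sym.
    apply/setP=> -[c d]; rewrite !inE /= /box_adj /= /star_adj (negbTE i0).
    rewrite (negbTE b0) xpair_eqE.
    case: (eqVneq c ord0) => [->|c0] /=.
      rewrite (negbTE i0) /= [d == b]eq_sym.
      by case: (eqVneq b d) => [<-|].
    rewrite orbF; case: (eqVneq i c) => [<-|] //=.
    by case: (eqVneq d ord0) => //= ->; rewrite eq_sym (negbTE (f0 _ i0)).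
  (* The neighbours [(c, 0)] are off the cross, and [b] is the only leaf available for a neighbour
     [(0, d)]. *)
  exists (ord0, ord0); first by rewrite !inE.
  apply/setP=> -[c d]; rewrite !inE /= /box_adj /= /star_adj xpair_eqE eqxx.
  case: (eqVneq c ord0) => [_|c0] /=.
    case: (eqVneq d ord0) => [->|d0] /=.
      by rewrite eq_sym (negbTE b0).
    by rewrite (one d d0) !eqxx.
  by case: (eqVneq ord0 d) => [<-|] //=; rewrite eq_sym (negbTE (f0 _ c0)).
exists (a, ord0); first by rewrite !inE /= (negbTE a0) eq_sym f0.
apply/setP=> -[c d]; rewrite !inE /= /box_adj /= /star_adj (negbTE a0) xpair_eqE.
case: (eqVneq c ord0) => [->|c0] /=.
  rewrite (negbTE a0) [ord0 == a]eq_sym (negbTE a0) /=.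
  by case: (eqVneq d ord0).
rewrite orbF; case: (eqVneq a c) => [<-|] //=.
by case: (eqVneq d ord0) => [->|] //=; rewrite eq_sym (negbTE (f0 _ a0)).
Qed.

End StarProduct.

Theorem theorem33 (r r' : nat) (hr' : 1 <= r') (hr : r' <= r) :
  gamma_sp (box (star r) (star r')) = r * r' + 1.
Proof.
(* Since [(r + 1) * (r' + 1) = (r * r' + 1) + (r + r')], both bounds can be read off complements,
   compared with [r + r']. *)
have cardV (S : {set box (star r) (star r')}) :
    #|S| + #|~: S| = r * r' + 1 + (r + r').
  rewrite cardsC card_prod !card_ord mulSnr mulnS addnS addn1 addSn.
  by rewrite [r + _ * _]addnC addnA.
have [[D sD <-] minD] := gamma_spP (box (star r) (star r')).
apply/eqP; rewrite eqn_leq; apply/andP; split; last first.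
  rewrite -(leq_add2r (r + r')) -(cardV D) leq_add2l.
  rewrite -(card_graph_cross (fun=> ord0)).
  exact: super_dominating_cover (@graph_cross0_cover r r') sD.
(* Capping at [r'] keeps [inord] exact and sends leaves to leaves. *)
pose f (i : 'I_r.+1) : 'I_r'.+1 := inord (minn i r').
have fE i : f i = minn i r' :> nat by rewrite inordK // ltnS geq_minr.
have f0 i : i != ord0 -> f i != ord0.
  by rewrite -!val_eqE /= fE -!lt0n leq_min hr' andbT.
have: super_dominating (~: graph_cross f).
  apply: super_dominating_graph_cross => // j j0.
  case: (ltnP 1 r') => [r'2|r'1]; last first.
    right=> k k0; apply: val_inj; move: j0 k0 (ltn_ord j) (ltn_ord k).
    rewrite -!val_eqE /= -!lt0n !ltnS => j0 k0 jr kr.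
    by apply/eqP; rewrite eqn_leq (leq_trans kr) ?(leq_trans jr) // (leq_trans r'1).
  left; have r1 : 1 < r.+1 by rewrite ltnS (leq_trans hr').
  have r2 : 2 < r.+1 by rewrite ltnS (leq_trans r'2).
  (* As [2 <= r' <= r], the leaves 1 and 2 exist and [f] fixes both: leaf 2 avoids [j = 1], and leaf
     1 avoids every other [j]. *)
  case: (eqVneq (j : nat) 1) => [j1|j1].
    exists (Ordinal r2) => //.
    by rewrite -val_eqE /= fE j1 /= (minn_idPl r'2).
  exists (Ordinal r1) => //.
  by rewrite -val_eqE /= fE (minn_idPl hr') eq_sym.
move/minD/leq_trans; apply.
by rewrite -(leq_add2l #|graph_cross f|) cardV card_graph_cross addnC.
Qed.
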